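(* Let $\tau_0,\tau_1>0$, and consider inputs $\mu_i=\mathcal N(m_i,\Sigma_i)\in\mathcal G_d^1$ with masses $a_i>0$ and weights $\lambda_i>0$, $\sum_{i=1}^n\lambda_i=1$, one of which, with index $o$, is called the outlying input. Fix $R<\infty$, $0<\underline\sigma\le\overline\sigma<\infty$ and the compact candidate set $$\mathcal K=\left\{\mathcal N(m,\Sigma):\|m\|\le R,\ \underline\sigma I\preceq\Sigma\preceq\overline\sigma I\right\}\subset\mathcal G_d^1.$$ Assume that there is an anchor index $j\ne o$ such that $\lambda_j a_j^\theta\ge c_*>0$ and $\mu_j\in\mathcal K_{\rm anc}$, where $c_*>0$ and the compact set $\mathcal K_{\rm anc}\subset\mathcal G_d^1$ are fixed. Let the outlying input have mass $a_o>0$, covariance $\Sigma_o\in\mathbb S_{++}^d$ satisfying $\Sigma_o\preceq\overline\sigma_oI$, and mean $m_o$. Then there exist constants $c,C>0$, depending only on $\mathcal K$, $\mathcal K_{\rm anc}$, $c_*$, $\tau_0,\tau_1$, $\lambda_o$ and $\overline\sigma_o$, but independent of $m_o$, $a_o$, the choice of admissible anchor, and all remaining inputs, such that $$\sup_{\nu\in\mathcal K}\omega_o(\nu)\le Ca_o^\theta e^{-c\|m_o\|^2},$$ $$\sup_{\nu=\mathcal N(m,\Sigma)\in\mathcal K}\omega_o(\nu)\|v_o(\nu)-m\|\le Ca_o^\theta(1+\|m_o\|)e^{-c\|m_o\|^2},$$ and, with $R_o(\nu):=Q_o(\nu)+(v_o(\nu)-m)(v_o(\nu)-m)^\top$, $$\sup_{\nu\in\mathcal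 K}\omega_o(\nu)\|R_o(\nu)\|_F\le Ca_o^\theta(1+\|m_o\|^2)e^{-c\|m_o\|^2}.$$
   Context: $\mathbb S_{++}^d$ is the set of real symmetric positive-definite $d\times d$ matrices; $\mathcal G_d^1=\{\mathcal N(m,\Sigma):m\in\mathbb R^d,\ \Sigma\in\mathbb S_{++}^d\}$, identified with the open set $\mathbb R^d\times\mathbb S_{++}^d$; compactness is in these coordinates. Put $s=\tau_0+\tau_1$, $\theta=\tau_0/s$. For $\mu,\nu\in\mathcal G_d^1$, $$\mathsf A(\mu,\nu)=\inf_{p,q\in\mathcal P(\mathbb R^d)}\{W_2^2(p,q)+\tau_0\mathrm{KL}(p\mid\mu)+\tau_1\mathrm{KL}(q\mid\nu)\},$$ with $\mathrm{KL}$ the relative entropy and $W_2^2(p,q)\in[0,\infty]$ the squared quadratic Wasserstein cost. It is known that this infimum has a unique minimizer $(p,q)$ and that $p,q$ are nondegenerate Gaussians. For input $i$ and $\nu\in\mathcal G_d^1$, $A_i(\nu)=\mathsf A(\mu_i,\nu)$, the second component of the minimizer for $(\mu_i,\nu)$ is written $q_i(\nu)=\mathcal N(v_i(\nu),Q_i(\nu))$, and $$\omega_i(\nu)=\frac{\lambda_i a_i^\theta e^{-A_i(\nu)/s}}{\sum_j\lambda_j a_j^\theta e^{-A_j(\nu)/s}}.$$ $\|\cdot\|_F$ is the Frobenius norm. *)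

(* Defs.v *)
From HB Require Import structures.
From mathcomp Require Import all_boot all_order all_algebra.
From mathcomp Require Import all_classical all_reals all_analysis.

Set Implicit Arguments.
Unset Strict Implicit.
Unset Printing Implicit Defensive.

Import Order.TTheory GRing.Theory Num.Theory.
Import numFieldNormedType.Exports.

Local Open Scope classical_set_scope.
Local Open Scope ring_scope.

Section linear_algebra.
Context {R : realType}.

(* The library norm on matrices is the sup norm. On column vectors, the
   Frobenius norm is the Euclidean norm. *)
Definition frob {m n} (A : 'M[R]_(m, n)) : R :=
  Num.sqrt (\sum_i \sum_j A i j ^+ 2).

Definition dotv {d} (u x : 'cV[R]_d) : R := (u^T *m x) 0 0.

Definition quadf {d} (A : 'M[R]_d) (x : 'cV[R]_d) : R := dotv x (A *m x).

Definition posdef {d} (A : 'M[R]_d) : Prop :=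
  A^T = A /\ forall x : 'cV[R]_d, x != 0 -> 0 < quadf A x.

(* Used on symmetric matrices only. *)
Definition loewner {d} (A B : 'M[R]_d) : Prop :=
  forall x : 'cV[R]_d, quadf A x <= quadf B x.

End linear_algebra.

(* R^d with its Borel sigma-algebra *)
Definition Rd (R : realType) (d : nat) := g_sigma_algebraType (@open 'cV[R]_d).

Section gaussian.
Context {R : realType} {d : nat}.

(* P is the law N(m, S): for u != 0, the linear functional <u, .> has under P
   the one-dimensional normal law of mean <u, m> and variance <u, S u>. The
   second parameter of normal_prob is the standard deviation; u = 0 would give
   the standard deviation 0, for which normal_prob is a junk value. *)
Definition normal_law (P : probability (Rd R d) R) (m : 'cV[R]_d)
    (S : 'M[R]_d) : Prop :=
  forall u : 'cV[R]_d, u != 0 -> forall B : set R, measurable B ->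
    P (dotv u @^-1` B) = normal_prob (dotv u m) (Num.sqrt (quadf S u)) B.

End gaussian.

(* The nondegenerate Gaussian measures on R^d, with their coordinates *)
Record gaussian (R : realType) (d : nat) := Gaussian {
  law :> probability (Rd R d) R ;
  mean : 'cV[R]_d ;
  cov : 'M[R]_d ;
  cov_posdef : posdef cov ;
  law_normal : normal_law law mean cov }.

Section transport.
Context {R : realType} {d : nat}.
Local Open Scope ereal_scope.

Definition KL (p mu : probability (Rd R d) R) : \bar R :=
  if `[< p `<< mu >]
  then \int[p]_x lne (Radon_Nikodym (charge_of_finite_measure p) mu x)
  else +oo.

Definition coupling (p q : probability (Rd R d) R)
    (g : probability (Rd R d * Rd R d)%type R) : Prop :=
  forall B : set (Rd R d), measurable B ->
    g (fst @^-1` B) = p B /\ g (snd @^-1` B) = q B.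

Definition W2sq (p q : probability (Rd R d) R) : \bar R :=
  ereal_inf [set \int[g]_z (frob ((z.1 : 'cV[R]_d) - z.2) ^+ 2)%:E
            | g in coupling p q].

Variables tau0 tau1 : R.
Implicit Types mu nu p q : probability (Rd R d) R.

Definition objective mu nu p q : \bar R :=
  W2sq p q + tau0%:E * KL p mu + tau1%:E * KL q nu.

Definition Aval mu nu : \bar R :=
  ereal_inf [set objective mu nu pq.1 pq.2 | pq in [set: _ * _]].

Definition minimizer mu nu p q : Prop :=
  forall p' q', objective mu nu p q <= objective mu nu p' q'.

(* The second component of the minimizing pair for (mu, nu), together with its
   Gaussian coordinates. The minimizing pair is known to exist, to be unique and
   to consist of nondegenerate Gaussians, so the default nu is never used. *)
Definition qmin (mu nu : gaussian R d) : gaussian R d :=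
  @xget {classic gaussian R d} nu [set q | exists p, minimizer mu nu p (law q)].

End transport.

Section weights.
Context {R : realType} {d : nat}.
Variables tau0 tau1 : R.

Definition theta : R := tau0 / (tau0 + tau1).

Variables (n : nat) (lam a : 'I_n -> R) (mu : 'I_n -> gaussian R d).

Definition weight (i : 'I_n) (nu : gaussian R d) : R :=
  lam i * a i `^ theta *
  fine (expeR (- (Aval tau0 tau1 (mu i) nu * ((tau0 + tau1)^-1)%:E)%E)).

Definition omega (i : 'I_n) (nu : gaussian R d) : R :=
  weight i nu / \sum_(j < n) weight j nu.

End weights.

Definition candidates {R : realType} {d : nat} (rho slo shi : R) :
    set (gaussian R d) :=
  [set nu | [/\ frob (mean nu) <= rho, loewner slo%:M (cov nu)
              & loewner (cov nu) shi%:M]].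

(* Main.v *)
(* Completing the square shows that a Gaussian whose covariance has diagonal at
   most V integrates exp((x_i - m_i)^2 / (4V)) to at most 2.  By the entropy
   inequality (b, p) <= KL(p | mu) + (exp b, mu), every p therefore has its
   second moment about the mean of mu controlled by KL(p | mu).  Two
   consequences: since |m_o - m|^2 is at most three times the sum of
   |x - m_o|^2, |x - y|^2 and |y - m|^2, the optimal value A_o(nu) grows at
   least like |m_o|^2; and since tau1 KL(q | nu) <= A_o(nu) at the minimizer, the
   trace of Q_o plus |v_o - m|^2 is at most linear in A_o(nu).  The anchor keeps
   the denominator of omega_o away from zero, because the pair (mu_j, nu) with
   the product coupling bounds A_j(nu).  Hence omega_o (1 + A_o), and with it all
   three quantities, is at most a constant times a_o^theta exp(- A_o / (2s)). *)

Require Import Defs.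
From HB Require Import structures.
From mathcomp Require Import all_boot all_order all_algebra.
From mathcomp Require Import all_classical all_reals all_analysis measurable_realfun.
From mathcomp Require Import ring lra.

Import Order.TTheory GRing.Theory Num.Theory.
Import numFieldNormedType.Exports.

Local Open Scope classical_set_scope.
Local Open Scope ring_scope.

(** * One-dimensional normal laws *)

Section normal.
Context {R : realType}.
Implicit Types m s c eta t V : R.

(** The Radon-Nikodym derivative of [normal_prob] and [normal_pdf] have the same integral over every
    measurable set, so they agree almost everywhere. *)
Lemma integral_normal_prob m s (F : R -> \bar R) :
  (forall t, 0 <= F t)%E -> measurable_fun [set: R] F ->
  (\int[normal_prob m s]_t F t =
   \int[lebesgue_measure]_t (F t * (normal_pdf m s t)%:E))%E.
Proof.
move=> F0 mF.
have dom := @normal_prob_dominates R m s.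
rewrite -(Radon_Nikodym_SigmaFinite.change_of_variables dom)//.
have RNi := Radon_Nikodym_SigmaFinite.f_integrable dom.
have mpdf : measurable_fun [set: R] (EFin \o normal_pdf m s).
  by apply/measurable_EFinP; exact: measurable_normal_pdf.
apply: ae_eq_integral => //.
- by apply: emeasurable_funM => //; exact: measurable_int RNi.
- exact: emeasurable_funM.
- apply: ae_eqe_mul2l; apply: integral_ae_eq => // E _ mE.
  by rewrite -Radon_Nikodym_SigmaFinite.f_integral.
Qed.

(** Completing the square turns the integrand times the density into a constant times another normal
    density. The sign of [eta] is free: a negative one gives exponential moments, a positive one
    serves for the lower bound on second moments. *)
Lemma integral_normal_expR_sqr m s c eta : 0 < s -> 0 < 1 + 2 * eta * s ^+ 2 ->
  (\int[normal_prob m s]_t (expR (- eta * (t - c) ^+ 2))%:E =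
  ((Num.sqrt (1 + 2 * eta * s ^+ 2))^-1 *
   expR (- eta * (m - c) ^+ 2 / (1 + 2 * eta * s ^+ 2)))%:E)%E.
Proof.
move=> s0; set k := 1 + _ => k0.
have sk0 : 0 < Num.sqrt k by rewrite sqrtr_gt0.
have mF : measurable_fun [set: R] (fun t : R => expR (- eta * (t - c) ^+ 2)).
  apply: measurableT_comp => //; apply: measurable_funM => //.
  by apply: measurable_funX; exact: measurable_funB.
rewrite integral_normal_prob//; last exact/measurable_EFinP.
(* Parameters of the tilted law: its precision is [1 / s^2 + 2 eta], and its mean is the
   precision-weighted average of [m] and [c]. *)
pose s' := s / Num.sqrt k.
pose m' := (m + 2 * eta * s ^+ 2 * c) / k.
have s'0 : 0 < s' by rewrite divr_gt0.
set K := (X in _ = X%:E).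
transitivity (\int[lebesgue_measure]_t (K%:E * (normal_pdf m' s' t)%:E))%E.
  apply: eq_integral => t _; rewrite -!EFinM; congr EFin.
  rewrite !normal_pdfE ?gt_eqF//.
  have -> : normal_peak s' = Num.sqrt k * normal_peak s.
    rewrite /normal_peak /s' expr_div_n sqr_sqrtr ?(ltW k0)//.
    rewrite (_ : s ^+ 2 / k * pi *+ 2 = s ^+ 2 * pi *+ 2 * k^-1); last first.
      by rewrite mulrAC mulrnAl.
    rewrite sqrtrM; last by rewrite mulrn_wge0// mulr_ge0 ?sqr_ge0 ?pi_ge0.
    by rewrite sqrtrV ?(ltW k0)// invfM invrK mulrC.
  rewrite /K /normal_fun.
  rewrite [LHS](_ : _ = normal_peak s * expR (- eta * (t - c) ^+ 2 + - (t - m) ^+ 2 / (s ^+ 2 *+ 2))); last first.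
    by rewrite expRD mulrCA.
  rewrite [RHS](_ : _ = normal_peak s * expR (- eta * (m - c) ^+ 2 / k + - (t - m') ^+ 2 / (s' ^+ 2 *+ 2))); last first.
    by rewrite expRD mulrACA mulKf ?gt_eqF.
  congr (_ * expR _).
  rewrite /m' /s' expr_div_n sqr_sqrtr ?(ltW k0)//.
  have sn : s != 0 by rewrite gt_eqF.
  have kn : k != 0 by rewrite gt_eqF.
  (* Eliminating [eta] in favour of [k] leaves a rational identity whose denominators are powers of
     [s] and [k] only. *)
  have etaE : eta = (k - 1) / (2 * s ^+ 2) by rewrite /k; field; rewrite sn.
  clear - etaE sn kn; rewrite {}etaE; clearbody k; field.
  by rewrite sn kn.
rewrite integralZl//; last exact: integrable_normal_pdf.
by rewrite integral_normal_pdf mule1.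
Qed.

(** The case [eta = - 1 / (4V)]: since [s^2 <= V], the quantity [k] stays above 1/2, so the
    prefactor is at most 2 and the exponent is at most doubled. *)
Lemma normal_expR_sqr_le m s c V : 0 < s -> s ^+ 2 <= V ->
  (\int[normal_prob m s]_t (expR ((t - c) ^+ 2 / (4 * V)))%:E <=
   (2 * expR ((m - c) ^+ 2 / (2 * V)))%:E)%E.
Proof.
move=> s0 sV.
have V0 : 0 < V by rewrite (lt_le_trans _ sV)// exprn_gt0.
pose eta := - (4 * V)^-1.
set k := 1 + 2 * eta * s ^+ 2.
have k2 : 2^-1 <= k.
  have -> : k = 1 - 2^-1 * (s ^+ 2 / V).
    by rewrite /k /eta; field; rewrite gt_eqF.
  have : s ^+ 2 / V <= 1 by rewrite ler_pdivrMr// mul1r.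
  lra.
have k0 : 0 < k by apply: lt_le_trans k2; rewrite invr_gt0.
have sk : 2^-1 <= Num.sqrt k.
  rewrite -(ler_pXn2r (n := 2))// ?nnegrE ?sqrtr_ge0 ?invr_ge0//.
  rewrite sqr_sqrtr ?(ltW k0)//; apply: le_trans k2.
  lra.
under eq_integral do rewrite -[_ / _]mulrC -[X in X * _]opprK -/eta.
rewrite integral_normal_expR_sqr// -/k lee_fin ler_pM//.
- rewrite -[leRHS]invrK lef_pV2// ?posrE ?invr_gt0//.
  by rewrite sqrtr_gt0.
- rewrite ler_expR /eta opprK ler_pdivrMr//.
  have -> : (4 * V)^-1 * (m - c) ^+ 2 = (m - c) ^+ 2 / (2 * V) * 2^-1.
    by field; rewrite gt_eqF.
  by rewrite ler_wpM2l// divr_ge0 ?sqr_ge0// mulr_ge0 ?ltW.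
Qed.

(* Apply [1 <= u + exp (- u)] to [u = (t - c)^2 / (s^2 + (m - c)^2)]. *)
Lemma normal_sqr_ge m s c : 0 < s ->
  (((s ^+ 2 + (m - c) ^+ 2) / 4)%:E <=
   \int[normal_prob m s]_t ((t - c) ^+ 2)%:E)%E.
Proof.
move=> s0; set D := _ + _.
have D0 : 0 < D by rewrite ltr_pwDl ?exprn_gt0// sqr_ge0.
pose x := s ^+ 2 / D.
have x0 : 0 <= x by rewrite divr_ge0 ?sqr_ge0 ?ltW.
have x1 : x <= 1 by rewrite ler_pdivrMr// mul1r lerDl sqr_ge0.
have dE : (m - c) ^+ 2 / D = 1 - x.
  by apply/eqP; rewrite eq_sym subr_eq -mulrDl [X in X / _]addrC divff// gt_eqF.
have kE : 1 + 2 * D^-1 * s ^+ 2 = 1 + 2 * x by rewrite /x; ring.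
have k0 : 0 < 1 + 2 * x by lra.
set q := Num.sqrt (1 + 2 * x).
have q0 : 0 < q by rewrite sqrtr_gt0.
have q2 : q ^+ 2 = 1 + 2 * x by rewrite sqr_sqrtr ?ltW.
(* This bounds the expectation of [exp (- u)]. By [1 + y <= exp y] it suffices that
   [4/3 <= (2 + x) / q], which after squaring is a polynomial inequality in [x]. *)
have K34 : q^-1 * expR (- ((1 - x) / (1 + 2 * x))) <= 3 / 4.
  rewrite expRN -invfM -(invf_div 4 3) lef_pV2 ?posrE ?mulr_gt0 ?expR_gt0//.
  apply: (@le_trans _ _ (q * (1 + (1 - x) / (1 + 2 * x)))); last first.
    by rewrite ler_pM2l// expR_ge1Dx.
  have -> : q * (1 + (1 - x) / (1 + 2 * x)) = (2 + x) / q.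
    by rewrite -q2; field : q2; rewrite gt_eqF.
  rewrite ler_pdivlMr// -(ler_pXn2r (n := 2))// ?nnegrE; [|nra|nra].
  by rewrite exprMn q2; nra.
have mX : measurable_fun [set: R] (fun t : R => (t - c) ^+ 2).
  by apply: measurable_funX; exact: measurable_funB.
have I0 : (0 <= \int[normal_prob m s]_t ((t - c) ^+ 2)%:E)%E.
  by apply: integral_ge0 => t _; rewrite lee_fin sqr_ge0.
have : (1 <= D^-1%:E * \int[normal_prob m s]_t ((t - c) ^+ 2)%:E + (3 / 4)%:E)%E.
  apply: (@le_trans _ _ (\int[normal_prob m s]_t
    ((D^-1 * (t - c) ^+ 2)%:E + (expR (- D^-1 * (t - c) ^+ 2))%:E))%E).
    rewrite -[leLHS](@probability_setT _ _ _ (normal_prob m s)).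
    rewrite -[leLHS]mul1e -integral_cst//; apply: ge0_le_integral => //.
    - apply: emeasurable_funD; apply/measurable_EFinP.
        exact: measurable_funM.
      apply: measurableT_comp => //; exact: measurable_funM.
    - move=> t _; rewrite -EFinD lee_fin mulNr.
      by have := expR_ge1Dx (- (D^-1 * (t - c) ^+ 2)); lra.
  rewrite ge0_integralD//.
  - rewrite integral_normal_expR_sqr// kE//.
    under eq_integral do rewrite EFinM.
    rewrite ge0_integralZl//.
    + rewrite leeD2l// lee_fin; apply: le_trans K34.
      by rewrite mulNr (mulrC D^-1) dE mulNr.
    + exact/measurable_EFinP.
    + by move=> t _; rewrite lee_fin sqr_ge0.
    + by rewrite lee_fin invr_ge0 ltW.
  - by move=> t _; rewrite lee_fin mulr_ge0 ?sqr_ge0// invr_ge0 ltW.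
  - by apply/measurable_EFinP; exact: measurable_funM.
  - apply/measurable_EFinP/measurableT_comp => //; exact: measurable_funM.
move: I0; case: (\int[_]_t _)%E => [r| |]// _; last by rewrite leey.
rewrite -EFinM -EFinD !lee_fin => h.
have {}h : 1 / 4 <= r / D by rewrite mulrC; lra.
by move: h; rewrite ler_pdivlMr//; lra.
Qed.
End normal.

(** * Relative entropy *)

Section relative_entropy.
Context {R : realType} {d : nat}.
Implicit Types (p mu : probability (Rd R d) R).
Local Open Scope ereal_scope.

Lemma measurable_lne_EFin d' (T : measurableType d') (r : T -> R) :
  measurable_fun [set: T] r -> measurable_fun [set: T] (fun x => lne (r x)%:E).
Proof.
move=> mr; rewrite [X in measurable_fun _ X](_ : _ = fun x =>
  if (r x <= 0)%R then -oo else (ln (r x))%:E)//.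
apply: measurable_fun_ifT => //; first exact: measurable_fun_ler.
apply/measurable_EFinP; exact: measurableT_comp.
Qed.

(** Replaces the extended-real derivative and [lne] in [KL] by a finite density and the real [ln].
    The two logarithms differ where the density vanishes, so positivity [p]-almost everywhere is
    part of the package. *)
Lemma KL_density p mu : p `<< mu -> exists r : Rd R d -> R,
  [/\ measurable_fun [set: Rd R d] r, forall x, (0 <= r x)%R,
      {ae p, forall x, (0 < r x)%R},
      (forall F : Rd R d -> \bar R, (forall x, 0 <= F x) ->
        measurable_fun [set: Rd R d] F ->
        \int[p]_x F x = \int[mu]_x (F x * (r x)%:E)) &
      KL p mu = \int[p]_x (ln (r x))%:E].
Proof.
move=> pmu.
have g0 := Radon_Nikodym_SigmaFinite.f_ge0 pmu.
have gfin := Radon_Nikodym_SigmaFinite.f_fin_num pmu.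
have gi := Radon_Nikodym_SigmaFinite.f_integrable pmu.
have gE := Radon_Nikodym_SigmaFinite.f_integral pmu.
have cv := Radon_Nikodym_SigmaFinite.change_of_variables pmu.
have RNg := ae_eq_Radon_Nikodym_SigmaFinite pmu measurableT.
set g := Radon_Nikodym_SigmaFinite.f p mu in g0 gfin gi gE cv RNg.
have mg : measurable_fun [set: Rd R d] g by exact: measurable_int gi.
pose r x := fine (g x).
have gr x : g x = (r x)%:E by rewrite fineK.
have mr : measurable_fun [set: Rd R d] r by exact: measurableT_comp.
have r0 x : (0 <= r x)%R by rewrite fine_ge0.
(* The [p]-mass of the zero set of [r] is the integral of [r] over that set. *)
have rpos : {ae p, forall x, (0 < r x)%R}.
  exists (r @^-1` [set 0%R]); split.
  - by rewrite -[X in measurable X]setTI; exact: mr.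
  - rewrite gE//; last by rewrite -[X in measurable X]setTI; exact: mr.
    by rewrite integral0_eq// => x /= rx; rewrite gr rx.
  - move=> x /= /negP; rewrite -leNgt => rx; apply/eqP.
    by rewrite eq_le rx r0.
exists r; split=> //.
- by move=> F F0 mF; rewrite -cv//; apply: eq_integral => x _; rewrite gr.
- rewrite /KL; case: asboolP => // _.
  have mRN : measurable_fun [set: Rd R d]
      (Radon_Nikodym (charge_of_finite_measure p) mu).
    exact/measurable_int/Radon_Nikodym_integrable.
  (* The two versions of the derivative agree [mu]-almost everywhere, hence [p]-almost everywhere by
     absolute continuity. *)
  have /(_ p pmu) RNp := null_dominates_ae_eq measurableT _ RNg.
  apply: ae_eq_integral => //.
  + rewrite (_ : (fun x => _) = fun x => lne (fine
        (Radon_Nikodym (charge_of_finite_measure p) mu x))%:E); last first.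
      by apply/funext => x; rewrite fineK// Radon_Nikodym_fin_num.
    exact/measurable_lne_EFin/measurableT_comp.
  + apply/measurable_EFinP; exact: measurableT_comp.
  + apply: filterS2 RNp rpos => x gRN rx _.
    by rewrite -gRN// gr lne_EFin.
Qed.

Lemma KL_refl mu : KL mu mu = 0.
Proof.
have mumu : mu `<< mu by [].
rewrite /KL; case: asboolP => // _.
set f := Radon_Nikodym _ _.
have fi : mu.-integrable setT f by exact: Radon_Nikodym_integrable.
have f1 : ae_eq mu setT f (cst 1).
  apply: integral_ae_eq => // E _ mE.
  by rewrite -Radon_Nikodym_integral// integral_cst// mul1e.
rewrite (ae_eq_integral (cst 0))//; first by rewrite integral0.
- rewrite (_ : (fun x => _) = fun x => lne (fine (f x))%:E); last first.
    by apply/funext => x; rewrite fineK// Radon_Nikodym_fin_num.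
  apply/measurable_lne_EFin/measurableT_comp => //.
  exact: measurable_int fi.
- by apply: filterS f1 => x /(_ I) /= -> _; rewrite lne1.
Qed.

(* With [r] the density of [p], [b + 1 <= ln r + e^b / r] wherever [0 < r].
   The negative part of [ln r] is put on the left-hand side, where it is
   dominated by [e^b / r], so that only nonnegative functions are integrated. *)
Lemma entropy_inequality p mu (b : Rd R d -> R) :
  (forall x, 0 <= b x)%R -> measurable_fun [set: Rd R d] b ->
  \int[mu]_x (expR (b x))%:E < +oo ->
  1 + \int[p]_x (b x)%:E <= KL p mu + \int[mu]_x (expR (b x))%:E.
Proof.
move=> b0 mb bfin.
have Eb0 : 0 <= \int[mu]_x (expR (b x))%:E.
  by apply: integral_ge0 => x _; rewrite lee_fin expR_ge0.
have [pmu|npmu] := pselect (p `<< mu); last first.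
  rewrite /KL asboolF// addye ?leey//.
  by rewrite gt_eqF// (lt_le_trans _ Eb0).
have [r [mr r0 rpos cv ->]] := KL_density _ _ pmu.
pose h x := ln (r x).
have mh : measurable_fun [set: Rd R d] h by exact: measurableT_comp.
pose w x := expR (b x - h x)%R.
have w0 x : (0 <= w x)%R by rewrite expR_ge0.
have mw : measurable_fun [set: Rd R d] w.
  by apply: measurableT_comp => //; exact: measurable_funB.
(* Here [w] is [e^b / r]. After the change of variables, [w r] equals [e^b] where [r] is positive
   and is 0 elsewhere, hence only an inequality. *)
have wle : \int[p]_x (w x)%:E <= \int[mu]_x (expR (b x))%:E.
  rewrite cv//; last exact/measurable_EFinP.
  apply: ge0_le_integral => //.
  - by move=> x _; rewrite -EFinM lee_fin mulr_ge0.
  - by apply: emeasurable_funM; apply/measurable_EFinP.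
  - by apply/measurable_EFinP; exact: measurableT_comp.
  - move=> x _; rewrite -EFinM lee_fin /w /h.
    have [->|rx] := eqVneq (r x) 0%R; first by rewrite mulr0 expR_ge0.
    by rewrite expRD expRN lnK ?posrE ?mulfVK// lt_def rx r0.
have key : {ae p, forall x, (b x + 1 <= h x + w x)%R}.
  by apply: filterS rpos => x rx; have := expR_ge1Dx (b x - h x); rewrite /w; lra.
pose hp x := Num.max (h x) 0%R.
pose hn x := Num.max (- h x)%R 0%R.
have hp0 x : (0 <= hp x)%R by rewrite le_max lexx orbT.
have hn0 x : (0 <= hn x)%R by rewrite le_max lexx orbT.
have mhp : measurable_fun [set: Rd R d] hp by exact: measurable_maxr.
have mhn : measurable_fun [set: Rd R d] hn.
  by apply: measurable_maxr => //; exact: measurableT_comp.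
have hpn x : (h x = hp x - hn x)%R.
  by rewrite /hp /hn; case: lerP => ?; case: lerP => ?; lra.
have hnw : {ae p, forall x, (hn x <= w x)%R}.
  apply: filterS key => x hw; rewrite /hn ge_max w0 andbT.
  by have := b0 x; lra.
have -> : \int[p]_x (ln (r x))%:E = \int[p]_x (hp x)%:E - \int[p]_x (hn x)%:E.
  rewrite integralE; congr (_ - _); apply: eq_integral => x _.
    by rewrite funeposE /hp EFin_max.
  by rewrite funenegE /hn EFin_max.
have le1 : \int[p]_x (hn x)%:E <= \int[p]_x (w x)%:E.
  apply: ae_ge0_le_integral => //; [|exact/measurable_EFinP| |exact/measurable_EFinP|].
  - by move=> x _; rewrite lee_fin.
  - by move=> x _; rewrite lee_fin.
  - by apply: filterS hnw => x hw _; rewrite lee_fin.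
(* The pointwise bound [key] with [h = hp - hn], rearranged so that both sides are sums of
   nonnegative terms before integrating. *)
have le2 : 1 + \int[p]_x (b x)%:E + \int[p]_x (hn x)%:E <=
    \int[p]_x (hp x)%:E + \int[p]_x (w x)%:E.
  have -> : 1 = \int[p]_x (cst 1 x) :> \bar R.
    by rewrite integral_cst// mul1e [RHS]probability_setT.
  have mbe : measurable_fun [set: Rd R d] (EFin \o b) by exact/measurable_EFinP.
  have mne : measurable_fun [set: Rd R d] (EFin \o hn) by exact/measurable_EFinP.
  have mpe : measurable_fun [set: Rd R d] (EFin \o hp) by exact/measurable_EFinP.
  have mwe : measurable_fun [set: Rd R d] (EFin \o w) by exact/measurable_EFinP.
  rewrite -!ge0_integralD//;
    try by [move=> x _; rewrite ?adde_ge0 ?lee_fin|exact: emeasurable_funD].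
  apply: ae_ge0_le_integral => //.
  - by move=> x _; rewrite !adde_ge0 ?lee_fin.
  - by do 2?apply: emeasurable_funD.
  - by move=> x _; rewrite !adde_ge0 ?lee_fin.
  - by do 2?apply: emeasurable_funD.
  - apply: filterS key => x hx _ /=; rewrite -!EFinD lee_fin.
    by move: hx; rewrite hpn; lra.
have P0 : 0 <= \int[p]_x (hp x)%:E by apply: integral_ge0 => x _; rewrite lee_fin.
have N0 : 0 <= \int[p]_x (hn x)%:E by apply: integral_ge0 => x _; rewrite lee_fin.
have W0 : 0 <= \int[p]_x (w x)%:E by apply: integral_ge0 => x _; rewrite lee_fin.
have A0 : 0 <= \int[p]_x (b x)%:E by apply: integral_ge0 => x _; rewrite lee_fin.
(* The chain [N <= W <= e < +oo] makes the subtraction of [N] legitimate; if [A] is infinite, then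
   so is [P]. Only the all-finite case remains for [lra]. *)
move: Eb0 bfin wle P0 N0 W0 A0 le1 le2.
move: (\int[mu]_x _) (\int[p]_x (hp x)%:E) (\int[p]_x (hn x)%:E)
  (\int[p]_x (w x)%:E) (\int[p]_x (b x)%:E).
move=> [e| |] [P| |] [N| |] [W| |] [A| |]//=;
  rewrite -?EFinD -?EFinB ?lee_fin ?leey//.
lra.
Qed.

End relative_entropy.

(** * Second moments and entropy *)

Section gaussian_coordinates.
Context {R : realType} {d : nat}.
Implicit Types (nu : gaussian R d) (p q : probability (Rd R d) R) (i : 'I_d).

(** Change of variables in the form in which [normal_law] and [coupling] supply it, as equality of
    measures on measurable sets. *)
Lemma ge0_integral_image d1 d2 (T1 : measurableType d1) (T2 : measurableType d2)
    (phi : T1 -> T2) (m1 : {measure set T1 -> \bar R})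
    (m2 : {measure set T2 -> \bar R}) (F : T2 -> \bar R) :
  measurable_fun setT phi ->
  (forall B, measurable B -> m1 (phi @^-1` B) = m2 B) ->
  (forall y, 0 <= F y)%E -> measurable_fun setT F ->
  (\int[m1]_x F (phi x) = \int[m2]_y F y)%E.
Proof.
move=> mphi m12 F0 mF.
rewrite -(@eq_measure_integral _ _ _ _ m2 (pushforward m1 phi))//.
  by rewrite (ge0_integral_pushforward mphi)// => y _; exact: F0.
by move=> B mB _; rewrite -m12.
Qed.

Lemma measurable_coord i :
  measurable_fun [set: Rd R d] (fun x => (x : 'cV[R]_d) i 0).
Proof.
apply: (measurability _ (RGenOpens.measurableE R)).
move=> _ [_ [a [b ->] <-]]; rewrite setTI.
apply: sub_sigma_algebra => /=.
apply: open_comp => [x _|]; first exact: coord_continuous.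
exact: interval_open.
Qed.

Lemma dotv_delta i (x : 'cV[R]_d) : dotv (delta_mx i 0) x = x i 0.
Proof. by rewrite /dotv trmx_delta -rowE mxE. Qed.

Lemma quadf_delta i (S : 'M[R]_d) : quadf S (delta_mx i 0) = S i i.
Proof. by rewrite /quadf dotv_delta -colE mxE. Qed.

Lemma delta_neq0 i : delta_mx i 0 != 0 :> 'cV[R]_d.
Proof.
by apply/negP => /eqP /matrixP /(_ i 0) /eqP; rewrite !mxE !eqxx oner_eq0.
Qed.

Lemma cov_diag_gt0 nu i : 0 < cov nu i i.
Proof.
by rewrite -quadf_delta; have [_] := cov_posdef nu; apply; exact: delta_neq0.
Qed.

Lemma integral_gaussian_coord nu i (F : R -> \bar R) :
  (forall t, 0 <= F t)%E -> measurable_fun setT F ->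
  (\int[nu]_x F ((x : 'cV[R]_d) i 0%R) =
   \int[normal_prob (mean nu i 0%R) (Num.sqrt (cov nu i i))]_t F t)%E.
Proof.
move=> F0 mF; apply: ge0_integral_image => //; first exact: measurable_coord.
move=> B mB; have := law_normal nu (delta_neq0 i) mB.
rewrite dotv_delta quadf_delta; apply: etrans; congr (law nu _).
by apply/funext => x /=; rewrite dotv_delta.
Qed.
End gaussian_coordinates.

Section moments.
Context {R : realType} {d : nat}.
Implicit Types (nu : gaussian R d) (p q : probability (Rd R d) R) (i : 'I_d).

Lemma frob_ge0 m n (A : 'M[R]_(m, n)) : 0 <= frob A.
Proof. exact: sqrtr_ge0. Qed.

Lemma frob_colE (x : 'cV[R]_d) : frob x ^+ 2 = \sum_i (x i 0) ^+ 2.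
Proof.
rewrite /frob sqr_sqrtr; last first.
  by apply: sumr_ge0 => i _; apply: sumr_ge0 => j _; exact: sqr_ge0.
by apply: eq_bigr => i _; rewrite big_ord1.
Qed.

Lemma measurable_sqr_coord i (c : R) : measurable_fun [set: Rd R d]
  (fun x => ((x : 'cV[R]_d) i 0 - c) ^+ 2).
Proof.
by apply: measurable_funX; apply: measurable_funB => //; exact: measurable_coord.
Qed.

Lemma integral_frob_sqr p (c : 'cV[R]_d) :
  (\int[p]_x (frob ((x : 'cV[R]_d) - c) ^+ 2)%:E =
   \sum_i \int[p]_x (((x : 'cV[R]_d) i 0%R - c i 0%R) ^+ 2)%:E)%E.
Proof.
rewrite -ge0_integral_sum//; first last.
- by move=> i x _; rewrite lee_fin sqr_ge0.
- by move=> i; apply/measurable_EFinP; exact: measurable_sqr_coord.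
apply: eq_integral => x _; rewrite frob_colE sumEFin; congr EFin.
by apply: eq_bigr => i _; rewrite !mxE.
Qed.

(** For each coordinate take [b = (x_i - m_i)^2 / (4V)] in the entropy inequality: its exponential
    has [nu]-integral at most 2, so its [q]-integral is at most [k + 1]. Summing over coordinates
    gives the factor [d]. *)
Lemma entropy_moment_bound nu q V k : (forall i, cov nu i i <= V) -> 0 < V ->
  KL q nu = k%:E ->
  (\int[q]_x (frob ((x : 'cV[R]_d) - mean nu) ^+ 2)%:E <=
   (4 * V * (k + 1) * d%:R)%:E)%E.
Proof.
move=> covV V0 KLk; rewrite integral_frob_sqr.
rewrite mulr_natr -[X in (_ *+ X)%R]card_ord -sumr_const -sumEFin.
apply: lee_sum => i _.
set s := Num.sqrt (cov nu i i).
have s0 : 0 < s by rewrite sqrtr_gt0 cov_diag_gt0.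
have sV : s ^+ 2 <= V by rewrite sqr_sqrtr// ltW// cov_diag_gt0.
pose b (x : Rd R d) := ((x : 'cV[R]_d) i 0 - mean nu i 0) ^+ 2 / (4 * V).
have b0 x : 0 <= b x by rewrite divr_ge0 ?sqr_ge0// mulr_ge0// ltW.
have mb : measurable_fun [set: Rd R d] b.
  by apply: measurable_funM => //; exact: measurable_sqr_coord.
have eb : (\int[law nu]_x (expR (b x))%:E <= 2%:E)%E.
  rewrite (@integral_gaussian_coord _ _ nu i
    (fun t => (expR ((t - mean nu i 0) ^+ 2 / (4 * V)))%:E)) -/s.
  - apply: le_trans (normal_expR_sqr_le _ _ (mean nu i 0) _ s0 sV) _.
    by rewrite subrr expr0n/= mul0r expR0 mulr1.
  - by move=> t; rewrite lee_fin expR_ge0.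
  - apply/measurable_EFinP/measurableT_comp => //.
    by apply: measurable_funM => //; apply: measurable_funX; exact: measurable_funB.
have := entropy_inequality q nu b b0 mb (le_lt_trans eb (ltry _)).
rewrite KLk => h.
have {}h : (\int[q]_x (b x)%:E <= (k + 1)%:E)%E.
  have := le_trans h (leeD2l _ eb).
  case: (\int[q]_x _)%E => [r| |]; rewrite ?leNye//.
  by rewrite -!EFinD !lee_fin; lra.
under eq_integral.
  move=> x _; rewrite (_ : _ ^+ 2 = 4 * V * b x); last first.
    by rewrite /b mulrCA divff ?mulr1// mulf_neq0// gt_eqF.
  rewrite EFinM; over.
rewrite ge0_integralZl//; last 3 first.
- exact/measurable_EFinP.
- by move=> x _; rewrite lee_fin.
- by rewrite lee_fin mulr_ge0// ltW.
by rewrite [leRHS]EFinM lee_pmul2l// lte_fin mulr_gt0.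
Qed.

(** The sum of [normal_sqr_ge] over the coordinates, which is also the origin of the factor 1/4. *)
Lemma gaussian_moment_ge nu (c : 'cV[R]_d) :
  (((\tr (cov nu) + frob (mean nu - c) ^+ 2) / 4)%:E <=
   \int[nu]_x (frob ((x : 'cV[R]_d) - c) ^+ 2)%:E)%E.
Proof.
rewrite integral_frob_sqr frob_colE /mxtrace -big_split/= mulr_suml -sumEFin.
apply: lee_sum => i _; rewrite !mxE.
set s := Num.sqrt (cov nu i i).
have s0 : 0 < s by rewrite sqrtr_gt0 cov_diag_gt0.
rewrite (@integral_gaussian_coord _ _ nu i
    (fun t => ((t - c i 0) ^+ 2)%:E)) -/s.
- have -> : cov nu i i = s ^+ 2 by rewrite sqr_sqrtr// ltW// cov_diag_gt0.
  exact: normal_sqr_ge.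
- by move=> t; rewrite lee_fin sqr_ge0.
- by apply/measurable_EFinP/measurable_funX; exact: measurable_funB.
Qed.

(** Coordinatewise, [t^2 <= 4V exp (t^2 / (4V))], and the exponential moment is already bounded. *)
Lemma gaussian_moment_le nu V M : (forall i, cov nu i i <= V) -> 0 < V ->
  (forall i, mean nu i 0 ^+ 2 <= M) ->
  (\int[nu]_x (frob (x : 'cV[R]_d) ^+ 2)%:E <=
   (4 * V * (2 * expR (M / (2 * V))) * d%:R)%:E)%E.
Proof.
move=> covV V0 meanM.
under eq_integral do rewrite -[X in frob X]subr0.
rewrite integral_frob_sqr.
rewrite mulr_natr -[X in (_ *+ X)%R]card_ord -sumr_const -sumEFin.
apply: lee_sum => i _.
set s := Num.sqrt (cov nu i i).
have s0 : 0 < s by rewrite sqrtr_gt0 cov_diag_gt0.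
have sV : s ^+ 2 <= V by rewrite sqr_sqrtr// ltW// cov_diag_gt0.
rewrite mxE (@integral_gaussian_coord _ _ nu i
    (fun t => ((t - 0) ^+ 2)%:E)) -/s; first last.
- by apply/measurable_EFinP/measurable_funX; exact: measurable_funB.
- by move=> t; rewrite lee_fin sqr_ge0.
have me : measurable_fun [set: R]
    (fun t : R => (expR ((t - 0) ^+ 2 / (4 * V)))%:E).
  apply/measurable_EFinP/measurableT_comp => //.
  by apply: measurable_funM => //; apply: measurable_funX; exact: measurable_funB.
have V4 : 0 < 4 * V by rewrite mulr_gt0.
apply: (@le_trans _ _ ((4 * V)%:E * \int[normal_prob (mean nu i 0%R) s]_t
    (expR ((t - 0) ^+ 2 / (4 * V)))%:E)%E).
  rewrite -ge0_integralZl//; last by rewrite lee_fin ltW.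
  apply: ge0_le_integral => //.
  - by move=> t _; rewrite lee_fin sqr_ge0.
  - by apply/measurable_EFinP/measurable_funX; exact: measurable_funB.
  - exact: emeasurable_funM.
  - move=> t _; rewrite -EFinM lee_fin mulrC -ler_pdivrMr//.
    by have := expR_ge1Dx ((t - 0) ^+ 2 / (4 * V)); lra.
rewrite [leRHS]EFinM lee_pmul2l// ?lte_fin//.
apply: le_trans (normal_expR_sqr_le _ _ _ _ s0 sV) _.
rewrite lee_fin ler_pM2l// ler_expR subr0 ler_pM2r//.
by rewrite invr_gt0 mulr_gt0.
Qed.
End moments.

(** * The transport problem *)

Section transport.
Context {R : realType} {d : nat}.
Implicit Types (mu nu p q : probability (Rd R d) R).
Implicit Types g : probability (Rd R d * Rd R d)%type R.

(** The entropy inequality at [b = 0] reads [1 <= KL p mu + 1]. *)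
Lemma KL_ge0 mu p : (0 <= KL p mu)%E.
Proof.
have E1 : (\int[mu]_x (expR ((cst 0 : Rd R d -> R) x))%:E = 1)%E.
  under eq_integral do rewrite /= expR0.
  by rewrite integral_cst// mul1e [LHS]probability_setT.
have := entropy_inequality p mu (cst 0) (fun=> lexx _) (measurable_cst _).
rewrite E1 ltry => /(_ isT).
under eq_integral do rewrite /=.
rewrite integral0 adde0.
by case: (KL p mu) => [r| |]//; rewrite -EFinD !lee_fin; lra.
Qed.

Lemma W2sq_ge0 p q : (0 <= W2sq p q)%E.
Proof.
apply: le_ereal_inf_tmp => _ [g _ <-].
by apply: integral_ge0 => z _; rewrite lee_fin sqr_ge0.
Qed.

Lemma objective_ge_KL tau0 tau1 mu nu p q : 0 <= tau0 ->
  (tau1%:E * KL q nu <= objective tau0 tau1 mu nu p q)%E.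
Proof.
by move=> t0; rewrite /objective leeDr// adde_ge0 ?W2sq_ge0// mule_ge0 ?KL_ge0.
Qed.

Lemma integral_coupling_fst p q g (F : Rd R d -> \bar R) : coupling p q g ->
  (forall x, 0 <= F x)%E -> measurable_fun setT F ->
  (\int[g]_z F z.1 = \int[p]_x F x)%E.
Proof.
move=> gc F0 mF; apply: ge0_integral_image => //.
by move=> B mB; case: (gc _ mB).
Qed.

Lemma integral_coupling_snd p q g (F : Rd R d -> \bar R) : coupling p q g ->
  (forall x, 0 <= F x)%E -> measurable_fun setT F ->
  (\int[g]_z F z.2 = \int[q]_x F x)%E.
Proof.
move=> gc F0 mF; apply: ge0_integral_image => //.
by move=> B mB; case: (gc _ mB).
Qed.

Lemma measurable_frob_sqr (c : 'cV[R]_d) : measurable_fun [set: Rd R d]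
  (fun x => frob ((x : 'cV[R]_d) - c) ^+ 2).
Proof.
rewrite (_ : (fun x => _) = fun x : Rd R d =>
    \sum_i ((x : 'cV[R]_d) i 0 - c i 0) ^+ 2); last first.
  by apply/funext => x; rewrite frob_colE; apply: eq_bigr => i _; rewrite !mxE.
by apply: measurable_sum => i; exact: measurable_sqr_coord.
Qed.

Lemma measurable_cost : measurable_fun [set: Rd R d * Rd R d]
  (fun z => frob ((z.1 : 'cV[R]_d) - z.2) ^+ 2).
Proof.
rewrite (_ : (fun z => _) = fun z : Rd R d * Rd R d =>
    \sum_i ((z.1 : 'cV[R]_d) i 0 - (z.2 : 'cV[R]_d) i 0) ^+ 2); last first.
  by apply/funext => x; rewrite frob_colE; apply: eq_bigr => i _; rewrite !mxE.
apply: measurable_sum => i; apply: measurable_funX; apply: measurable_funB.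
  by apply: (measurableT_comp (measurable_coord i)).
by apply: (measurableT_comp (measurable_coord i)).
Qed.

Lemma frob_sqr_triangle (x y a b : 'cV[R]_d) : frob (a - b) ^+ 2 <=
  3 * frob (x - a) ^+ 2 + 3 * frob (x - y) ^+ 2 + 3 * frob (y - b) ^+ 2.
Proof.
rewrite !frob_colE !mulr_sumr -!big_split/=; apply: ler_sum => i _.
rewrite !mxE; set x' := x i 0; set y' := y i 0; set a' := a i 0.
set b' := b i 0.
(* The identity [3 (u^2 + v^2 + w^2) - (u + v + w)^2 = (u - v)^2 + (v - w)^2 + (u - w)^2] at
   [u = a' - x'], [v = x' - y'], [w = y' - b']. *)
rewrite -subr_ge0 (_ : _ - _ = ((x' - a') + (x' - y')) ^+ 2 +
  ((x' - y') - (y' - b')) ^+ 2 + ((x' - a') + (y' - b')) ^+ 2).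
  by rewrite !addr_ge0 ?sqr_ge0.
ring.
Qed.

Lemma frob_sqr_le2 (x y : 'cV[R]_d) :
  frob (x - y) ^+ 2 <= 2 * frob x ^+ 2 + 2 * frob y ^+ 2.
Proof.
rewrite !frob_colE !mulr_sumr -!big_split/=; apply: ler_sum => i _.
by rewrite !mxE; have := sqr_ge0 (x i 0 + y i 0); lra.
Qed.

(** Integrate [frob_sqr_triangle] against [g]: the left side is constant, and the two outer terms
    depend on one marginal each. *)
Lemma coupling_cost_ge p q g (a b : 'cV[R]_d) : coupling p q g ->
  ((frob (a - b) ^+ 2)%:E <=
   3%:E * \int[p]_x (frob ((x : 'cV[R]_d) - a) ^+ 2)%:E +
   3%:E * \int[g]_z (frob ((z.1 : 'cV[R]_d) - z.2) ^+ 2)%:E +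
   3%:E * \int[q]_y (frob ((y : 'cV[R]_d) - b) ^+ 2)%:E)%E.
Proof.
move=> gc.
have ma c := measurable_frob_sqr c.
have mc := measurable_cost.
rewrite -(integral_coupling_fst _ _ _
    (fun x => (frob ((x : 'cV[R]_d) - a) ^+ 2)%:E) gc)//; last 2 first.
- by move=> x; rewrite lee_fin sqr_ge0.
- exact/measurable_EFinP.
rewrite -(integral_coupling_snd _ _ _
    (fun x => (frob ((x : 'cV[R]_d) - b) ^+ 2)%:E) gc)//; last 2 first.
- by move=> x; rewrite lee_fin sqr_ge0.
- exact/measurable_EFinP.
have m1 : measurable_fun [set: Rd R d * Rd R d]
    (fun z => (frob ((z.1 : 'cV[R]_d) - a) ^+ 2)%:E).
  by apply/measurable_EFinP; exact: (measurableT_comp (ma a)).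
have m2 : measurable_fun [set: Rd R d * Rd R d]
    (fun z => (frob ((z.2 : 'cV[R]_d) - b) ^+ 2)%:E).
  by apply/measurable_EFinP; exact: (measurableT_comp (ma b)).
have m3 : measurable_fun [set: Rd R d * Rd R d]
    (fun z => (frob ((z.1 : 'cV[R]_d) - z.2) ^+ 2)%:E).
  exact/measurable_EFinP.
rewrite -!ge0_integralZl//;
  try by move=> z _; rewrite lee_fin sqr_ge0.
have nn (h : Rd R d * Rd R d -> R) :
    (forall z, setT z -> 0 <= 3%:E * (h z ^+ 2)%:E)%E.
  by move=> z _; rewrite -EFinM lee_fin mulr_ge0 ?sqr_ge0.
have mm (h : Rd R d * Rd R d -> \bar R) : measurable_fun setT h ->
    measurable_fun setT (fun z => 3%:E * h z)%E.
  by move=> mh; exact: emeasurable_funM.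
rewrite -ge0_integralD//; [|exact: nn|exact: mm|exact: nn|exact: mm].
rewrite -ge0_integralD//; [|by move=> z _; rewrite adde_ge0// mule_ge0// lee_fin sqr_ge0|
  by apply: emeasurable_funD; exact: mm|exact: nn|exact: mm].
rewrite -[leLHS]mule1 -(@probability_setT _ _ _ g) -integral_cst//.
apply: ge0_le_integral => //.
- by move=> z _; rewrite lee_fin sqr_ge0.
- by do 2?apply: emeasurable_funD; exact: mm.
- by move=> z _; rewrite -!EFinM -!EFinD lee_fin frob_sqr_triangle.
Qed.

Lemma product_coupling p q : coupling p q (p \x q)%E.
Proof.
move=> B mB; split.
- have -> : fst @^-1` B = B `*` [set: Rd R d].
    by apply/seteqP; split=> [[x y]|[x y] []].
  transitivity (p B * q setT)%E; first exact: product_measure1E.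
  by rewrite probability_setT mule1.
- have -> : snd @^-1` B = [set: Rd R d] `*` B.
    by apply/seteqP; split=> [[x y]|[x y] []].
  transitivity (p setT * q B)%E; first exact: product_measure1E.
  by rewrite probability_setT mul1e.
Qed.

(** Both entropies vanish at the pair ([mu], [nu]), and the product coupling bounds the transport
    cost. *)
Lemma objective_self_le tau0 tau1 mu nu : (objective tau0 tau1 mu nu mu nu <=
  2%:E * \int[mu]_x (frob (x : 'cV[R]_d) ^+ 2)%:E +
  2%:E * \int[nu]_x (frob (x : 'cV[R]_d) ^+ 2)%:E)%E.
Proof.
rewrite /objective !KL_refl !mule0 !adde0.
have gc := product_coupling mu nu.
apply: (@le_trans _ _ (\int[(mu \x nu)%E]_z
    (frob ((z.1 : 'cV[R]_d) - z.2) ^+ 2)%:E)%E).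
  by apply: ereal_inf_lbound; exists (mu \x nu)%E.
have ma : measurable_fun [set: Rd R d]
    (fun x => (frob (x : 'cV[R]_d) ^+ 2)%:E).
  apply/measurable_EFinP; have := measurable_frob_sqr 0.
  by under eq_fun do rewrite subr0.
have a0 (x : Rd R d) : (0 <= (frob (x : 'cV[R]_d) ^+ 2)%:E)%E.
  by rewrite lee_fin sqr_ge0.
rewrite -(integral_coupling_fst _ _ _ _ gc a0 ma).
rewrite -(integral_coupling_snd _ _ _ _ gc a0 ma).
have m1 : measurable_fun [set: Rd R d * Rd R d]
    (fun z => (frob (z.1 : 'cV[R]_d) ^+ 2)%:E).
  exact: (measurableT_comp ma).
have m2 : measurable_fun [set: Rd R d * Rd R d]
    (fun z => (frob (z.2 : 'cV[R]_d) ^+ 2)%:E).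
  exact: (measurableT_comp ma).
rewrite -!ge0_integralZl// -ge0_integralD//;
  try by [exact: emeasurable_funM|move=> z _; rewrite mule_ge0].
apply: ge0_le_integral => //.
- by apply/measurable_EFinP; exact: measurable_cost.
- by apply: emeasurable_funD; exact: emeasurable_funM.
- by move=> z _; rewrite -!EFinM -!EFinD lee_fin frob_sqr_le2.
Qed.
End transport.

(** * Entrywise bounds for positive definite matrices and compact sets of coordinates *)

Section matrix_bounds.
Context {R : realType} {d : nat}.
Implicit Types (Q : 'M[R]_d) (w : 'cV[R]_d) (i j : 'I_d).

Lemma frob_le (A : 'M[R]_d) T : 0 <= T -> (forall i j, `|A i j| <= T) ->
  frob A <= d%:R * T.
Proof.
move=> T0 AT; rewrite -(ler_pXn2r (n := 2))// ?nnegrE ?sqrtr_ge0 ?mulr_ge0//.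
rewrite sqr_sqrtr; last first.
  by apply: sumr_ge0 => i _; apply: sumr_ge0 => j _; exact: sqr_ge0.
apply: (@le_trans _ _ (\sum_(i < d) \sum_(j < d) T ^+ 2)).
  apply: ler_sum => i _; apply: ler_sum => j _.
  by rewrite -real_normK ?num_real// lerXn2r ?nnegrE.
by rewrite !sumr_const card_ord -mulrnA -[leLHS]mulr_natr natrM exprMn -expr2 mulrC.
Qed.

Lemma posdef_ge0 Q (x : 'cV[R]_d) : posdef Q -> 0 <= quadf Q x.
Proof.
move=> [_ Qpos]; have [->|x0] := eqVneq x 0; last exact/ltW/Qpos.
by rewrite /quadf /dotv trmx0 mul0mx mxE.
Qed.

Lemma quadf_pair Q i j (e : R) : quadf Q (delta_mx i 0 + e *: delta_mx j 0) =
  Q i i + e * (Q i j + Q j i) + e ^+ 2 * Q j j.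
Proof.
have dotvDl (u v x : 'cV[R]_d) : dotv (u + v) x = dotv u x + dotv v x.
  by rewrite /dotv linearD/= mulmxDl mxE.
have dotvZl (u x : 'cV[R]_d) (f : R) : dotv (f *: u) x = f * dotv u x.
  by rewrite /dotv linearZ/= -scalemxAl mxE.
rewrite /quadf dotvDl dotvZl !dotv_delta mulmxDr -scalemxAr -!colE !mxE.
ring.
Qed.

Lemma posdef_diag_le_tr Q i : posdef Q -> Q i i <= \tr Q.
Proof.
move=> Qpos; rewrite /mxtrace (bigD1 i)//= lerDl sumr_ge0// => j _.
by rewrite -quadf_delta posdef_ge0.
Qed.

(** Nonnegativity of the form at [e_i + e_j] and [e_i - e_j] gives [2 |Q i j| <= Q i i + Q j j]. *)
Lemma posdef_entry_le Q i j : posdef Q -> `|Q i j| <= \tr Q.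
Proof.
move=> Qpos; have Qsym : Q j i = Q i j by rewrite -[in LHS](proj1 Qpos) mxE.
have := posdef_ge0 Q (delta_mx i 0 + 1 *: delta_mx j 0) Qpos.
have := posdef_ge0 Q (delta_mx i 0 + (-1) *: delta_mx j 0) Qpos.
rewrite !quadf_pair Qsym ler_norml.
have := posdef_diag_le_tr Q i Qpos; have := posdef_diag_le_tr Q j Qpos.
by move=> *; apply/andP; split; lra.
Qed.

Lemma sqr_coord_le w i : w i 0 ^+ 2 <= frob w ^+ 2.
Proof.
by rewrite frob_colE (bigD1 i)//= lerDl sumr_ge0// => j _; exact: sqr_ge0.
Qed.

Lemma frob_cov_outer_le Q w : posdef Q ->
  frob (Q + w *m w^T) <= d%:R * (\tr Q + frob w ^+ 2).
Proof.
move=> Qpos; apply: frob_le.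
  rewrite addr_ge0 ?sqr_ge0// /mxtrace sumr_ge0// => i _.
  by rewrite -quadf_delta posdef_ge0.
move=> i j; rewrite mxE; apply: (le_trans (ler_normD _ _)).
apply: lerD; first exact: posdef_entry_le.
rewrite mxE big_ord1 !mxE ler_norml.
have := sqr_coord_le w i; have := sqr_coord_le w j.
have := sqr_ge0 (w i 0 + w j 0); have := sqr_ge0 (w i 0 - w j 0).
by move=> *; apply/andP; split; lra.
Qed.

Lemma loewner_diag_le Q V i : loewner Q V%:M -> Q i i <= V.
Proof. by move=> /(_ (delta_mx i 0)); rewrite !quadf_delta !mxE eqxx. Qed.

Lemma compact_coord_bound (K : set ('cV[R]_d * 'M[R]_d)) : compact K ->
  exists2 M : R, 0 <= M &
    forall g, K g -> forall i, g.1 i 0 ^+ 2 <= M /\ g.2 i i <= M.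
Proof.
move=> /compact_bounded[N [_ KN]].
(* Strictly above [N], as boundedness requires, and at least 1, so that [B <= B^2] and one constant
   bounds squared means and variances alike. *)
pose B := Num.max N 0 + 1.
have B1 : 1 <= B by rewrite /B lerDr le_max lexx orbT.
have NB : N < B by rewrite /B (@le_lt_trans _ _ (Num.max N 0)) ?le_max ?lexx ?ltrDl.
exists (B ^+ 2); first exact: sqr_ge0.
move=> g /(KN _ NB) gB i.
have g1B : `|g.1| <= B by apply: le_trans gB; rewrite /Num.norm/= le_max lexx.
have g2B : `|g.2| <= B by apply: le_trans gB; rewrite /Num.norm/= le_max lexx orbT.
have entry m n (A : 'M[R]_(m, n)) k l : `|A k l| <= `|A|.
  rewrite [leRHS]mx_normrE.
  exact: (le_bigmax _ (fun ij : 'I_m * 'I_n => `|A ij.1 ij.2|) (k, l)).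
have B0 : 0 <= B by exact: le_trans B1.
split.
  rewrite -real_normK ?num_real// lerXn2r ?nnegrE//.
  exact: le_trans (entry _ _ _ _ _) g1B.
apply: le_trans (ler_norm _) _; apply: le_trans (entry _ _ _ _ _) _.
by apply: le_trans g2B _; rewrite expr2 ler_peMl.
Qed.

End matrix_bounds.

(** * Two-sided bounds on the optimal value and moments of the minimizer *)

Section optimal_value.
Context {R : realType} {d : nat}.
Variables (tau0 tau1 : R).
Hypotheses (tau0_gt0 : 0 < tau0) (tau1_gt0 : 0 < tau1).
Implicit Types mu nu : gaussian R d.

Lemma objective_ge0 (mu nu p q : probability (Rd R d) R) :
  (0 <= objective tau0 tau1 mu nu p q)%E.
Proof.
by rewrite /objective !adde_ge0 ?W2sq_ge0// mule_ge0 ?KL_ge0// lee_fin ltW.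
Qed.

Lemma Aval_ge0 mu nu : (0 <= Aval tau0 tau1 mu nu)%E.
Proof. by apply: le_ereal_inf_tmp => _ [pq _ <-]; exact: objective_ge0. Qed.

(** With [L = 12 V d], the coupling and moment bounds give [D <= 3 W + L (kp + 1) + L (kq + 1)]. The
    denominator is chosen so that its product with the objective dominates [3 W + L kp + L kq]. *)
Lemma objective_ge mu nu V (p q : probability (Rd R d) R) :
  (forall i, cov mu i i <= V) -> (forall i, cov nu i i <= V) -> 0 < V ->
  (((frob (mean mu - mean nu) ^+ 2 - 2 * (12 * V * d%:R)) /
     (3 + 12 * V * d%:R / tau0 + 12 * V * d%:R / tau1))%:E <=
   objective tau0 tau1 mu nu p q)%E.
Proof.
move=> muV nuV V0; set L := 12 * V * d%:R; set D := frob _ ^+ 2.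
have L0 : 0 <= L by rewrite !mulr_ge0// ltW.
have := KL_ge0 mu p; have := KL_ge0 nu q.
case kpE : (KL p mu) => [kp| |]//; case kqE : (KL q nu) => [kq| |]// kq0 kp0.
- have WD : (((D - L * (kp + 1) - L * (kq + 1)) / 3)%:E <= W2sq p q)%E.
    apply: le_ereal_inf_tmp => _ [g gc <-].
    have := coupling_cost_ge p q g (mean mu) (mean nu) gc; rewrite -/D => Dle.
    have Ip := entropy_moment_bound mu p V kp muV V0 kpE.
    have Iq := entropy_moment_bound nu q V kq nuV V0 kqE.
    have p3 : (0 <= 3%:E :> \bar R)%E by rewrite lee_fin.
    have := le_trans Dle (leeD (leeD2r _ (lee_wpmul2l p3 Ip)) (lee_wpmul2l p3 Iq)).
    have : (0 <= \int[g]_z (frob ((z.1 : 'cV[R]_d) - z.2) ^+ 2)%:E)%E.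
      by apply: integral_ge0 => z _; rewrite lee_fin sqr_ge0.
    case: (\int[g]_z _)%E => [r| |]//; rewrite ?leey// => _.
    rewrite -!EFinM -!EFinD !lee_fin ler_pdivrMr// /L.
    by move: (d%:R : R) => d'; lra.
  have := W2sq_ge0 p q; move: WD; rewrite /objective kpE kqE.
  case: (W2sq p q) => [W| |]//; rewrite ?leey// -!EFinM -!EFinD !lee_fin.
  move=> WD W0; move: kp0 kq0; rewrite !lee_fin => kp0 kq0.
  rewrite ler_pdivrMr; last by rewrite !ltr_pwDl ?divr_ge0 ?(ltW tau0_gt0) ?(ltW tau1_gt0).
  have -> : (W + tau0 * kp + tau1 * kq) * (3 + L / tau0 + L / tau1) =
      3 * W + L * kp + L * kq + (3 * tau0 * kp + 3 * tau1 * kq +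
      (L / tau0) * (W + tau1 * kq) + (L / tau1) * (W + tau0 * kp)).
    by field; rewrite !gt_eqF.
  apply: (@le_trans _ _ (3 * W + L * kp + L * kq)).
    by move: WD; rewrite ler_pdivrMr//; lra.
  rewrite lerDl; have t0 := ltW tau0_gt0; have t1 := ltW tau1_gt0.
  have Lt0 : 0 <= L / tau0 by exact: divr_ge0.
  have Lt1 : 0 <= L / tau1 by exact: divr_ge0.
  have tk0 : 0 <= tau0 * kp by exact: mulr_ge0.
  have tk1 : 0 <= tau1 * kq by exact: mulr_ge0.
  have Wk0 : 0 <= W + tau0 * kp by exact: addr_ge0.
  have Wk1 : 0 <= W + tau1 * kq by exact: addr_ge0.
  have := mulr_ge0 Lt0 Wk1; have := mulr_ge0 Lt1 Wk0; lra.
(* In the three remaining cases some entropy is infinite, and with it the objective. *)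
- rewrite /objective kqE gt0_muley ?lte_fin// addey ?leey//.
  have := W2sq_ge0 p q; rewrite kpE; case: (W2sq p q) => //.
- rewrite /objective kpE gt0_muley ?lte_fin// [(W2sq p q + _)%E]addey; last first.
    by have := W2sq_ge0 p q; case: (W2sq p q).
  by rewrite kqE addye ?leey.
- rewrite /objective kpE kqE !gt0_muley ?lte_fin// [(W2sq p q + _)%E]addey; last first.
    by have := W2sq_ge0 p q; case: (W2sq p q).
  by rewrite addye ?leey.
Qed.

Lemma Aval_ge mu nu V :
  (forall i, cov mu i i <= V) -> (forall i, cov nu i i <= V) -> 0 < V ->
  (((frob (mean mu - mean nu) ^+ 2 - 2 * (12 * V * d%:R)) /
     (3 + 12 * V * d%:R / tau0 + 12 * V * d%:R / tau1))%:E <=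
   Aval tau0 tau1 mu nu)%E.
Proof.
by move=> *; apply: le_ereal_inf_tmp => _ [pq _ <-]; exact: objective_ge.
Qed.

Lemma Aval_le mu nu V :
  (forall i, cov mu i i <= V) -> (forall i, cov nu i i <= V) -> 0 < V ->
  (forall i, mean mu i 0 ^+ 2 <= V) -> (forall i, mean nu i 0 ^+ 2 <= V) ->
  (Aval tau0 tau1 mu nu <=
   (4 * (4 * V * (2 * expR (V / (2 * V))) * d%:R))%:E)%E.
Proof.
move=> muV nuV V0 mmuV mnuV; apply: ge_ereal_inf.
exists (objective tau0 tau1 mu nu mu nu); first by exists (law mu, law nu).
apply: le_trans (objective_self_le _ _ _ _) _.
have Imu := gaussian_moment_le mu V V muV V0 mmuV.
have Inu := gaussian_moment_le nu V V nuV V0 mnuV.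
have p2 : (0 <= 2%:E :> \bar R)%E by rewrite lee_fin.
apply: le_trans (leeD (lee_wpmul2l p2 Imu) (lee_wpmul2l p2 Inu)) _.
by rewrite -!EFinM -EFinD lee_fin; move: (_ * d%:R) => K; lra.
Qed.

(** At a minimizer [tau1 KL(q | nu) <= A], so the entropy bounds the second moment of [q] about the
    mean of [nu] from above, while [gaussian_moment_ge] bounds it from below by the trace and the
    displacement. *)
Lemma qmin_moment_le mu nu V (A : R) : (forall i, cov nu i i <= V) -> 0 < V ->
  Aval tau0 tau1 mu nu = A%:E ->
  \tr (cov (qmin tau0 tau1 mu nu)) +
    frob (mean (qmin tau0 tau1 mu nu) - mean nu) ^+ 2 <=
  16 * V * d%:R * (1 + tau1^-1) * (1 + A).
Proof.
move=> nuV V0 AE; set q := qmin _ _ _ _.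
have A0 : 0 <= A by have := Aval_ge0 mu nu; rewrite AE lee_fin.
have V160 : 0 <= 16 * V * d%:R by rewrite !mulr_ge0// ltW.
have t1 : 0 < tau1^-1 by rewrite invr_gt0.
(* [xget] returns a minimizing component or the default [nu]; for the default the displacement is 0
   and the trace is at most [V d]. *)
have [qm|->] : (exists p, minimizer tau0 tau1 mu nu p (law q)) \/ q = nu.
  by rewrite /q /qmin; case: xgetP => [y _ h|_]; [left|right].
- have [p pm] := qm.
  have oA : (objective tau0 tau1 mu nu p q <= A%:E)%E.
    by rewrite -AE; apply: le_ereal_inf_tmp => _ [[p' q'] _ <-]; exact: pm.
  have kA := le_trans (objective_ge_KL tau0 tau1 mu nu p q (ltW tau0_gt0)) oA.
  have := KL_ge0 nu q; case kE : (KL q nu) kA => [k| |]//; last first.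
    by rewrite gt0_muley.
  rewrite -EFinM !lee_fin => kA k0.
  have {}kA : k <= A * tau1^-1 by rewrite ler_pdivlMr// mulrC.
  have := le_trans (gaussian_moment_ge q (mean nu))
    (entropy_moment_bound nu q V k nuV V0 kE).
  rewrite lee_fin ler_pdivrMr// => /le_trans; apply.
  have -> : 4 * V * (k + 1) * d%:R * 4 = 16 * V * d%:R * (k + 1).
    by move: (d%:R : R) => d'; ring.
  move: (16 * V * d%:R) V160 => K K0; rewrite -mulrA ler_wpM2l//.
  by move: (tau1^-1) t1 kA => t t0 kA; nra.
- rewrite subrr.
  have -> : frob (0 : 'cV[R]_d) ^+ 2 = 0.
    by rewrite frob_colE big1// => i _; rewrite mxE expr0n.
  rewrite addr0; apply: (@le_trans _ _ (V * d%:R)).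
    rewrite /mxtrace mulr_natr -[X in _ *+ X]card_ord -sumr_const.
    exact: ler_sum.
  have -> : 16 * V * d%:R * (1 + tau1^-1) * (1 + A) =
    V * d%:R + V * d%:R * (15 + 16 * (tau1^-1 * (1 + A) + A)).
    by move: (d%:R : R) => d'; ring.
  rewrite lerDl !mulr_ge0 ?(ltW V0)//.
  by rewrite addr_ge0// mulr_ge0// addr_ge0// mulr_ge0 ?(ltW t1)// addr_ge0.
Qed.

End optimal_value.

(** * Weights *)

Section weights.
Context {R : realType} {d : nat}.
Variables (tau0 tau1 : R).
Hypotheses (tau0_gt0 : 0 < tau0) (tau1_gt0 : 0 < tau1).
Variables (n : nat) (lam a : 'I_n -> R) (mu : 'I_n -> gaussian R d).
Hypothesis lam_gt0 : forall i, 0 < lam i.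
Hypothesis sum_lam : \sum_(i < n) lam i = 1.
Implicit Types (nu : gaussian R d) (i j o : 'I_n).

Local Notation s := (tau0 + tau1).
Local Notation weight := (weight tau0 tau1 lam a mu).
Local Notation omega := (omega tau0 tau1 lam a mu).

Lemma weightE i nu A : Aval tau0 tau1 (mu i) nu = A%:E ->
  weight i nu = lam i * a i `^ theta tau0 tau1 * expR (- (A / s)).
Proof. by move=> AE; rewrite /Defs.weight AE. Qed.

Lemma weight_ge0 i nu : 0 <= weight i nu.
Proof.
by rewrite !mulr_ge0 ?powR_ge0 ?(ltW (lam_gt0 i))// fine_ge0// expeR_ge0.
Qed.

Lemma lam_le1 i : lam i <= 1.
Proof.
rewrite -sum_lam (bigD1 i)//= lerDl sumr_ge0// => j _.
exact: ltW.
Qed.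

(** The anchor term alone bounds the denominator below by [cstar exp (- B / s)]; in the numerator
    [lam o <= 1]. *)
Lemma omega_le o j nu A B cstar : 0 < cstar ->
  cstar <= lam j * a j `^ theta tau0 tau1 ->
  Aval tau0 tau1 (mu o) nu = A%:E ->
  (Aval tau0 tau1 (mu j) nu <= B%:E)%E ->
  omega o nu <= a o `^ theta tau0 tau1 * expR (- (A / s)) *
                (expR (B / s) / cstar).
Proof.
move=> c0 cj AE.
have s0 : 0 < s by rewrite addr_gt0.
have := Aval_ge0 _ _ tau0_gt0 tau1_gt0 (mu j) nu.
case BE : (Aval tau0 tau1 (mu j) nu) => [B'| |]// _; rewrite lee_fin => BB.
have wj : cstar / expR (B / s) <= weight j nu.
  rewrite (weightE _ _ _ BE) -expRN ler_pM ?expR_ge0 ?(ltW c0)//.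
  by rewrite ler_expR lerN2 ler_pM2r ?invr_gt0.
have wj0 : 0 < cstar / expR (B / s) by rewrite divr_gt0// expR_gt0.
have wS : cstar / expR (B / s) <= \sum_(i < n) weight i nu.
  apply: (le_trans wj); rewrite (bigD1 j isT) lerDl.
  by apply: sumr_ge0 => i _; exact: weight_ge0.
rewrite /Defs.omega; apply: ler_pM.
- exact: weight_ge0.
- by rewrite invr_ge0; apply: sumr_ge0 => i _; exact: weight_ge0.
- rewrite (weightE _ _ _ AE) ler_wpM2r ?expR_ge0//.
  by rewrite ler_piMl ?powR_ge0 ?lam_le1.
- by rewrite -[leRHS]invf_div lef_pV2// posrE// (lt_le_trans wj0).
Qed.

Lemma omega_ge0 o nu : 0 <= omega o nu.
Proof.
by apply: divr_ge0; [|apply: sumr_ge0 => i _]; exact: weight_ge0.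
Qed.

(** Since [expeR] vanishes at [-oo], an infinite value carries no weight; later estimates may take
    the value finite. *)
Lemma omega_eq0 o nu : (Aval tau0 tau1 (mu o) nu = +oo)%E -> omega o nu = 0.
Proof.
move=> AE; rewrite /Defs.omega {1}/Defs.weight AE.
by rewrite gt0_mulye ?lte_fin ?invr_gt0 ?addr_gt0// mulr0 mul0r.
Qed.
End weights.

(** Split [exp (- A / s)] into two equal factors. One absorbs the linear term through
    [1 + A <= (1 + 2s) exp (A / (2s))]; the other turns the lower bound on [A] into decay in [x]. *)
Lemma expR_absorb {R : realType} (s A al be x H : R) :
  0 < s -> 0 <= A -> al * x - be <= A -> 0 <= H ->
  (1 + H * (1 + A)) * expR (- (A / s)) <=
  (1 + H) * (1 + 2 * s) * expR (be / (2 * s)) * expR (- (al / (2 * s) * x)).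
Proof.
move=> s0 A0 lA H0.
have s20 : 0 < 2 * s by rewrite mulr_gt0.
set e := expR (A / (2 * s)).
have e0 : 0 < e by exact: expR_gt0.
have -> : expR (- (A / s)) = e^-1 * e^-1.
  rewrite -!expRN -expRD; congr expR; field.
  by rewrite gt_eqF.
have h1 : 1 + A <= (1 + 2 * s) * e.
  have := expR_ge1Dx (A / (2 * s)); rewrite -/e => he.
  apply: le_trans (ler_wpM2l _ he); last by rewrite addr_ge0// ltW.
  rewrite (_ : (1 + 2 * s) * _ = 1 + A + (2 * s + A / (2 * s))); last first.
    by field; rewrite gt_eqF.
  by rewrite lerDl addr_ge0 ?divr_ge0// ltW.
have h2 : e^-1 <= expR (be / (2 * s)) * expR (- (al / (2 * s) * x)).
  rewrite -expRN -expRD ler_expR -subr_ge0.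
  rewrite (_ : _ - _ = (A - (al * x - be)) / (2 * s)); last first.
    by field; rewrite gt_eqF.
  by rewrite divr_ge0 ?subr_ge0// ltW.
have h3 : (1 + H * (1 + A)) * e^-1 <= (1 + H) * (1 + 2 * s).
  rewrite ler_pdivrMr// -mulrA.
  apply: (@le_trans _ _ ((1 + H) * (1 + A))); first by nra.
  by rewrite ler_wpM2l// addr_ge0.
rewrite mulrA -[leRHS]mulrA ler_pM// ?invr_ge0 ?(ltW e0)//.
by rewrite divr_ge0 ?(ltW e0)// addr_ge0// mulr_ge0// addr_ge0.
Qed.

(** * Choice of uniform constants and conclusion *)

Theorem proposition3p12 (R : realType) (d : nat) (d_gt0 : (0 < d)%N)
  (tau0 tau1 : R) (tau0_gt0 : 0 < tau0) (tau1_gt0 : 0 < tau1)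
  (rho slo shi : R) (slo_gt0 : 0 < slo) (slo_shi : slo <= shi)
  (Kanc : set ('cV[R]_d * 'M[R]_d)) (Kanc_compact : compact Kanc)
  (Kanc_posdef : Kanc `<=` [set g | posdef g.2])
  (cstar : R) (cstar_gt0 : 0 < cstar) (lamo sbo : R) :
  exists c C : R, [/\ 0 < c, 0 < C &
    forall (n : nat) (mu : 'I_n -> gaussian R d) (a lam : 'I_n -> R)
      (o j : 'I_n),
      (forall i, 0 < a i) -> (forall i, 0 < lam i) ->
      \sum_(i < n) lam i = 1 ->
      lam o = lamo -> loewner (cov (mu o)) sbo%:M ->
      j != o -> cstar <= lam j * a j `^ theta tau0 tau1 ->
      Kanc (mean (mu j), cov (mu j)) ->
      let K := candidates rho slo shi : set (gaussian R d) in
      let om nu := omega tau0 tau1 lam a mu o nu in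
      let v nu := mean (qmin tau0 tau1 (mu o) nu) in
      let Q nu := cov (qmin tau0 tau1 (mu o) nu) in
      let Ro nu := Q nu + (v nu - mean nu) *m (v nu - mean nu)^T in
      let mo := frob (mean (mu o)) in
      let B := C * a o `^ theta tau0 tau1 in
      let E := expR (- (c * mo ^+ 2)) in
      [/\ (ereal_sup [set (om nu)%:E | nu in K] <= (B * E)%:E)%E,
          (ereal_sup [set (om nu * frob (v nu - mean nu))%:E | nu in K]
             <= (B * (1 + mo) * E)%:E)%E &
          (ereal_sup [set (om nu * frob (Ro nu))%:E | nu in K]
             <= (B * (1 + mo ^+ 2) * E)%:E)%E]].
Proof.
have [M M0 KM] := compact_coord_bound Kanc Kanc_compact.
have shi0 : 0 < shi by exact: lt_le_trans slo_shi.
have sbo0 := normr_ge0 sbo; have sboN := ler_norm sbo; have rho0 := sqr_ge0 rho.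
(* One bound for all diagonal covariances (candidates, outlier, anchor) and for the squared mean
   coordinates of candidates and anchor; the absolute value is there because [sbo] has no prescribed
   sign. *)
pose V := shi + `|sbo| + M + rho ^+ 2.
have V0 : 0 < V by rewrite /V; lra.
have Vshi : shi <= V by rewrite /V; lra.
have Vsbo : sbo <= V by rewrite /V; lra.
have VM : M <= V by rewrite /V; lra.
have Vrho : rho ^+ 2 <= V by rewrite /V; lra.
clearbody V.
pose L := 12 * V * d%:R.
have L0 : 0 <= L by rewrite !mulr_ge0// ltW.
pose Z := 3 + L / tau0 + L / tau1.
have Z0 : 0 < Z.
  by rewrite !ltr_pwDl ?divr_ge0 ?(ltW tau0_gt0) ?(ltW tau1_gt0).
pose s := tau0 + tau1.
have s0 : 0 < s by rewrite addr_gt0.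
pose H := 16 * V * d%:R * (1 + tau1^-1).
have H0 : 0 <= H.
  by rewrite !mulr_ge0 ?(ltW V0)// addr_ge0// invr_ge0 ltW.
pose B := 4 * (4 * V * (2 * expR (V / (2 * V))) * d%:R).
(* From [|m_o|^2 <= 2 |m_o - m|^2 + 2 rho^2], the lower bound on the value becomes
   [al |m_o|^2 - be <= A]. *)
pose al := (2 * Z)^-1.
have al0 : 0 < al by rewrite invr_gt0 mulr_gt0.
pose be := (rho ^+ 2 + 2 * L) / Z.
(* The constant of [expR_absorb] times the anchor factor of [omega_le]. *)
pose C := (1 + H) * (1 + 2 * s) * expR (be / (2 * s)) * (expR (B / s) / cstar).
have C0 : 0 < C.
  have H1 : 0 < 1 + H by rewrite ltr_pwDl.
  have s1 : 0 < 1 + 2 * s by rewrite addr_gt0// mulr_gt0.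
  by rewrite !mulr_gt0 ?expR_gt0 ?invr_gt0.
(* Half of the decay rate is left after the absorption; the extra [d] pays for the Frobenius norm in
   the third estimate. *)
exists (al / (2 * s)); exists (d%:R * C).
have dR : 1 <= d%:R :> R by rewrite ler1n.
split; [by rewrite divr_gt0// mulr_gt0|by rewrite mulr_gt0// (lt_le_trans ltr01)|].
move=> n mu a lam o j a0 lam0 sum1 _ covo _ cj Kj K om v Q Ro mo B' E.
have E0 : 0 <= E by exact: expR_ge0.
pose T nu := \tr (Q nu) + frob (v nu - mean nu) ^+ 2.
have T0 nu : 0 <= T nu.
  rewrite addr_ge0 ?sqr_ge0// /mxtrace sumr_ge0// => i _.
  exact/ltW/cov_diag_gt0.
have at0 : 0 <= a o `^ theta tau0 tau1 by exact: powR_ge0.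
have om0 nu : 0 <= om nu by exact: omega_ge0.
have CaE0 : 0 <= C * a o `^ theta tau0 tau1 * E.
  by apply: mulr_ge0 => //; apply: mulr_ge0 => //; exact: ltW.
(* A single estimate, without polynomial factor in [mo], from which all three follow. *)
have key nu : K nu -> om nu * (1 + T nu) <= C * a o `^ theta tau0 tau1 * E.
  move=> [nurho _ nushi].
  have := Aval_ge0 _ _ tau0_gt0 tau1_gt0 (mu o) nu.
  case AE : (Aval tau0 tau1 (mu o) nu) => [A| |]// A0; last first.
    have -> : om nu = 0 by exact: omega_eq0.
    by rewrite mul0r.
  have nuV i : cov nu i i <= V.
    by apply: le_trans Vshi; exact: loewner_diag_le.
  have muoV i : cov (mu o) i i <= V.
    by apply: le_trans Vsbo; exact: loewner_diag_le.
  have mujV i : cov (mu j) i i <= V.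
    by apply: le_trans VM; case: (KM _ Kj i).
  have mmuj i : mean (mu j) i 0 ^+ 2 <= V.
    by apply: le_trans VM; case: (KM _ Kj i).
  have nurho2 : frob (mean nu) ^+ 2 <= rho ^+ 2.
    by rewrite lerXn2r ?nnegrE ?frob_ge0// (le_trans (frob_ge0 _ _ (mean nu))).
  have mnu i : mean nu i 0 ^+ 2 <= V.
    apply: le_trans Vrho; apply: le_trans nurho2; exact: sqr_coord_le.
  have jB := Aval_le tau0 tau1 (mu j) nu V mujV nuV V0 mmuj mnu.
  have omle := omega_le _ _ tau0_gt0 tau1_gt0 _ _ _ _ lam0 sum1 o j nu A B cstar
    cstar_gt0 cj AE jB.
  have := Aval_ge _ _ tau0_gt0 tau1_gt0 (mu o) nu V muoV nuV V0.
  rewrite AE lee_fin -/L -/Z => Age.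
  have {}Age : al * mo ^+ 2 - be <= A.
    apply: le_trans Age; rewrite /al /be invfM [2^-1 * _]mulrC -mulrA mulrC.
    rewrite -mulrBl ler_pM2r ?invr_gt0//.
    have := frob_sqr_le2 (mean (mu o) - mean nu) (- mean nu).
    have -> : frob (- mean nu) = frob (mean nu).
      congr Num.sqrt; apply: eq_bigr => i _; apply: eq_bigr => k _.
      by rewrite mxE sqrrN.
    rewrite opprK subrK -/mo; lra.
  have TA : 1 + T nu <= 1 + H * (1 + A).
    by rewrite lerD2l; exact: qmin_moment_le.
  have ab := expR_absorb s A al be (mo ^+ 2) H s0 A0 Age H0.
  apply: (@le_trans _ _ (a o `^ theta tau0 tau1 * expR (- (A / s)) *
    (expR (B / s) / cstar) * (1 + H * (1 + A)))).
    by apply: ler_pM => //; rewrite addr_ge0.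
  rewrite (_ : _ * _ = a o `^ theta tau0 tau1 * (expR (B / s) / cstar) *
    ((1 + H * (1 + A)) * expR (- (A / s)))); last by rewrite mulrAC -!mulrA; congr (_ * _); ring.
  have -> : C * a o `^ theta tau0 tau1 * E =
    a o `^ theta tau0 tau1 * (expR (B / s) / cstar) *
    ((1 + H) * (1 + 2 * s) * expR (be / (2 * s)) * E) by rewrite /C; ring.
  rewrite ler_wpM2l// mulr_ge0// divr_ge0 ?expR_ge0//.
  exact: ltW.
have mo0 : 0 <= mo by exact: frob_ge0.
have BE : B' * E = d%:R * (C * a o `^ theta tau0 tau1 * E).
  by rewrite /B' !mulrA.
have CB : C * a o `^ theta tau0 tau1 * E <= B' * E by rewrite BE ler_peMl.
have BE0 : 0 <= B' * E by exact: le_trans CB.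
(* Inserts the factors [1 + mo] and [1 + mo ^+ 2] of the claim, which are at least 1. *)
have up r : 0 <= r -> B' * E <= B' * (1 + r) * E.
  by move=> r0; rewrite [leRHS]mulrAC ler_peMr// lerDl.
split; apply: ge_ereal_sup => _ [nu Knu <-]; rewrite lee_fin.
- apply: le_trans CB; apply: le_trans (key _ Knu).
  by rewrite ler_peMr// lerDl.
- apply: le_trans (up _ mo0); apply: le_trans CB; apply: le_trans (key _ Knu).
  rewrite ler_wpM2l//.
  have w0 := frob_ge0 _ _ (v nu - mean nu).
  have : frob (v nu - mean nu) ^+ 2 <= T nu.
    rewrite lerDr /mxtrace sumr_ge0// => i _; exact/ltW/cov_diag_gt0.
  (* The norm enters through [w <= 1 + w^2 <= 1 + T nu]. *)
  by move: (frob _) w0 => w w0; nra.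
- apply: le_trans (up _ (sqr_ge0 _)); rewrite BE.
  apply: le_trans (ler_wpM2l _ (key _ Knu)) => //.
  rewrite mulrCA ler_wpM2l//.
  apply: le_trans (frob_cov_outer_le _ _ (cov_posdef _)) _.
  by rewrite ler_wpM2l// lerDr.
Qed.
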